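(* Let $q=p^m$ be a prime power and let $\mathbb{F}_q$ be the finite field with $q$ elements. Let $A\subset\mathbb{F}_q$ and $B\subset\mathbb{F}_q$ be such that $B$ is symmetric, i.e. $B=-B$, and $|A||B|>q$. Then $8AB=\mathbb{F}_q$.
   Context: For $X,Y\subset\mathbb{F}_q$, $XY=\{xy: x\in X, y\in Y\}$, and for a natural number $k$, $kX=\{x_1+\dots+x_k: x_1,\dots,x_k\in X\}$; thus $8AB$ is the set of all sums of $8$ elements of $AB$. Also $-B=\{-b:b\in B\}$. *)

(* Defs.v *)
From HB Require Import structures.
From mathcomp Require Import all_boot all_order all_algebra all_field.
Set Implicit Arguments.
Unset Strict Implicit.
Unset Printing Implicit Defensive.
Import GRing.Theory.
Local Open Scope ring_scope.

Definition prodset (F : finFieldType) (X Y : {set F}) : {set F} :=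
  [set x * y | x in X, y in Y].

Definition sumset (F : finFieldType) (k : nat) (X : {set F}) : {set F} :=
  [set \sum_(i < k) f i | f : {ffun 'I_k -> F} in ffun_on (mem X)].

Definition oppset (F : finFieldType) (X : {set F}) : {set F} :=
  [set - x | x in X].

(* Main.v *)
Require Import Defs.
From HB Require Import structures.
From mathcomp Require Import all_boot all_order all_algebra all_field.
From mathcomp Require Import ring zify.
Set Implicit Arguments.
Unset Strict Implicit.
Unset Printing Implicit Defensive.
Import GRing.Theory.
Local Open Scope ring_scope.

(** Averaging the additive energy of [A] and [x B] over the nonzero dilations
    [x] yields, by Cauchy-Schwarz, some [x] with [|A + x B| > q / 2].  Since
    [|A| |B| > q], the map [(a, b) |-> a + x b] is not injective on [A * B],
    so [x = (a1 - a2) / (b2 - b1)] for some [a1], [a2] in [A] and [b1], [b2] in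
    [B].  Hence [(b2 - b1) A + (a1 - a2) B], which lies in [4AB] because [B] is
    symmetric, has more than [q / 2] elements, and a set with more than half of
    the elements of a finite group added to itself gives the whole group. *)

(** Grouping pairs by their common value turns the collision count into the sum of the squared fibre
    sizes [r s], while the sizes themselves add up to [#|D|]; Cauchy-Schwarz compares the two
    sums. *)
Lemma card_sqr_le_imset_collisions (T U : finType) (D : {set T}) (f : T -> U) :
  (#|D| ^ 2 <= #|f @: D| * \sum_(u in D) \sum_(v in D) (f u == f v))%N.
Proof.
pose r s := (\sum_(u in D) (f u == s))%N.
have cardD : #|D| = (\sum_(s in f @: D) r s)%N.
  rewrite -sum1_card exchange_big /=; apply: eq_bigr => u uD.
  rewrite (bigD1 (f u)) ?imset_f //= eqxx big1 // => s /andP[_ sNfu].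
  by rewrite eq_sym (negbTE sNfu).
have -> : (\sum_(u in D) \sum_(v in D) (f u == f v) =
           \sum_(s in f @: D) r s ^ 2)%N.
  rewrite (partition_big f (mem (f @: D))) => [|u uD]; last exact: imset_f.
  apply: eq_bigr => s _ /=.
  transitivity (\sum_(u in D | f u == s) r s)%N.
    apply: eq_bigr => u /andP[_ /eqP <-].
    by apply: eq_bigr => v _; rewrite eq_sym.
  rewrite expnS expn1 {2}/r big_distrl /= big_mkcondr /=.
  by apply: eq_bigr => u _; case: eqP => _; rewrite ?mul1n ?mul0n.
(* The factor 2 makes room for [2 * (r s * r t) <= r s ^ 2 + r t ^ 2], summed over all pairs [s],
   [t]. *)
rewrite -(leq_pmul2l (isT : (0 < 2)%N)) cardD expnS expn1 big_distrlr /=.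
rewrite big_distrr /=.
apply: (@leq_trans (\sum_(s in f @: D) \sum_(t in f @: D)
                      (r s ^ 2 + r t ^ 2))%N).
  apply: leq_sum => s _; rewrite big_distrr /=.
  by apply: leq_sum => t _; exact: nat_Cauchy.
under eq_bigr do rewrite big_split /= sum_nat_const.
by rewrite big_split /= sum_nat_const -big_distrr /= addnn mul2n.
Qed.

Section FiniteField.

Variable F : finFieldType.
Implicit Types (A B S X : {set F}) (u v : F * F).

(** The collision equation is linear in [x]. It always holds when [u = v], has no nonzero solution
    when exactly one coordinate agrees, and has at most one when both differ. *)
Lemma card_colliding_dilations u v :
  (\sum_(x : F | x != 0%R) (u.1 + x * u.2 == v.1 + x * v.2)%R <=
   (u == v) * #|F|.-1 + ((u.1 != v.1) && (u.2 != v.2)))%N.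
Proof.
case: u v => [a b] [c d] /=.
have [<-|ac] := eqVneq a c.
  have [<-|bd] := eqVneq b d.
    rewrite eqxx mul1n addn0; under eq_bigr do rewrite eqxx.
    by rewrite sum1_card -(cardC1 (0 : F)).
  rewrite big1 // => x x0; apply/eqP; rewrite eqb0.
  by apply: contra bd => /eqP/addrI/(mulfI x0)/eqP.
have [<-|bd] := eqVneq b d.
  rewrite big1 // => x _; apply/eqP; rewrite eqb0.
  by apply: contra ac => /eqP/addIr/eqP.
have db : d - b != 0 by rewrite subr_eq0 eq_sym.
have key x : (a + x * b == c + x * d) = (x == (a - c) / (d - b)).
  apply/eqP/eqP => [e|->]; last by field.
  by apply: (mulIf db); rewrite mulfVK // (canRL (addrK _) e); ring.
under eq_bigr do rewrite key.
apply: leq_trans (leq_addl _ _) => /=.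
rewrite -(card1 ((a - c) / (d - b))) -sum1_card big_mkcond [leqRHS]big_mkcond.
by apply: leq_sum => x _; rewrite inE; case: ifP => //; case: eqP.
Qed.

Lemma exists_large_dilated_sum A B :
  (#|F| < #|A| * #|B|)%N ->
  exists2 x : F, x != 0 &
    (#|F| < 2 * #|[set (u.1 + x * u.2)%R | u in setX A B]|)%N.
Proof.
move=> ltF; set D := setX A B.
suff: [exists (x : F | x != 0%R),
        #|F| < 2 * #|[set (u.1 + x * u.2)%R | u in D]|]%N by move/exists_inP.
apply: contraT; rewrite negb_exists_in => /forall_inP small.
have F1 : (1 < #|F|)%N by exact: finNzRing_gt1.
have cardD : #|D| = (#|A| * #|B|)%N by rewrite cardsX.
pose E (x : F) := (\sum_(u in D) \sum_(v in D)
                     (u.1 + x * u.2 == v.1 + x * v.2)%R)%N.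
(* An image of at most [#|F| / 2] elements forces many collisions. *)
have lowE x : x != 0 -> (2 * #|D| ^ 2 <= #|F| * E x)%N.
  move=> /small; rewrite -leqNgt => leF.
  have := card_sqr_le_imset_collisions D (fun u => u.1 + x * u.2).
  rewrite -/(E x) => le2; apply: leq_trans (leq_mul leF (leqnn (E x))).
  by rewrite -mulnA leq_mul2l.
(* A fixed [u] in [D] collides with itself for all [#|F|.-1] dilations, and at most once with each
   of the [#|A|.-1 * #|B|.-1] pairs that differ from it in both coordinates. *)
have upE : (\sum_(x : F | x != 0%R) E x <=
            #|D| * (#|F|.-1 + #|A|.-1 * #|B|.-1))%N.
  rewrite /E exchange_big /= -sum_nat_const; apply: leq_sum => -[a b] abD.
  rewrite exchange_big /=.
  apply: leq_trans (leq_sum _ (fun v _ => card_colliding_dilations (a, b) v)) _.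
  rewrite big_split /= leq_add //.
    rewrite (bigD1 (a, b)) //= eqxx mul1n big1 ?addn0 // => v /andP[_ vab].
    by rewrite eq_sym (negbTE vab).
  case/setXP: (abD) => aA bB.
  have -> : (#|A|.-1 * #|B|.-1)%N = #|setX (A :\ a) (B :\ b)|.
    by rewrite cardsX (cardsD1 a A) (cardsD1 b B) aA bB.
  rewrite -sum1_card big_mkcond [leqRHS]big_mkcond /=.
  apply: leq_sum => -[c d] _; rewrite !in_setX !inE (eq_sym c) (eq_sym d).
  by case: (c \in A); case: (d \in B); case: eqP; case: eqP.
have : (#|F|.-1 * (2 * #|D| ^ 2) <=
        #|F| * (#|D| * (#|F|.-1 + #|A|.-1 * #|B|.-1)))%N.
  apply: leq_trans (leq_mul (leqnn _) upE).
  rewrite -(cardC1 (0 : F)) -sum_nat_const big_distrr /=.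
  exact: leq_sum.
rewrite cardD; move: ltF F1.
move: #|F| #|A| #|B| => [|[|q]] // [|a] [|b] //= {small lowE upE E cardD D}.
  by rewrite muln0.
move=> ltq _; have N0 : (0 < a.+1 * b.+1)%N by [].
have -> : (q.+1 * (2 * (a.+1 * b.+1) ^ 2) =
           a.+1 * b.+1 * (q.+1 * (2 * (a.+1 * b.+1))))%N by ring.
rewrite [leqRHS]mulnCA leq_pmul2l // => le2.
(* Now [q.+2] stands for [#|F|]. With [N = a.+1 * b.+1], [le2] rearranges to
   [q * (N - q.+2) + q.+2 * (a + b) <= 0], which fails since [N > q.+2] and [a + b > 0]. *)
have t0 : (0 < a + b)%N by nia.
have : (q * q.+2 <= q * (a * b + a + b))%N.
  by rewrite leq_mul2l; apply/orP; right; nia.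
have : (1 <= q.+1 * (a + b))%N by rewrite muln_gt0.
nia.
Qed.

(** [S] and its reflection [x - S] each fill more than half of [F], so they meet. *)
Lemma large_set_addition S (x : F) :
  (#|F| < 2 * #|S|)%N -> exists2 s, s \in S & x - s \in S.
Proof.
move=> big; pose T := [set x - s | s in S].
have cT : #|T| = #|S| by apply: card_imset => s t /addrI/oppr_inj.
have : (0 < #|S :&: T|)%N.
  rewrite lt0n; apply: contraL big => /eqP disjST.
  by rewrite -leqNgt mul2n -addnn -{2}cT -cardsUI disjST addn0 max_card.
case/card_gt0P => t /setIP[tS /imsetP[s sS ts]].
by exists s; rewrite -?ts.
Qed.

Lemma sumsetD k l X x y :
  x \in sumset k X -> y \in sumset l X -> x + y \in sumset (k + l) X.
Proof.
case/imsetP => f /ffun_onP fX -> /imsetP[g /ffun_onP gX ->].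
apply/imsetP; exists [ffun i : 'I_(k + l) =>
  match split i with inl j => f j | inr j => g j end].
  by apply/ffun_onP => i; rewrite ffunE; case: (split i).
rewrite big_split_ord /=; congr (_ + _); apply: eq_bigr => i _; rewrite ffunE.
  by rewrite (unsplitK (inl i)).
by rewrite (unsplitK (inr i)).
Qed.

Lemma sumset1 X x : x \in X -> x \in sumset 1 X.
Proof.
move=> xX; apply/imsetP; exists [ffun=> x]; last by rewrite big_ord1 ffunE.
by apply/ffun_onP => i; rewrite ffunE.
Qed.

End FiniteField.

Theorem theorem8 (p m q : nat) (F : finFieldType) (A B : {set F})
  (p_prime : prime p) (m_gt0 : (0 < m)%N) (q_def : q = (p ^ m)%N)
  (card_F : #|F| = q)
  (B_sym : B = oppset B)
  (card_AB : (q < #|A| * #|B|)%N) :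
  sumset 8 (prodset A B) = [set: F].
Proof.
rewrite -card_F in card_AB.
have oppB b : b \in B -> - b \in B by move=> bB; rewrite B_sym imset_f.
have [x x0 large] := exists_large_dilated_sum card_AB.
set f := fun u : F * F => _ in large.
have : ~~ dinjectiveb f (setX A B).
  apply/negP => /dinjectiveP/card_in_imset e.
  by have := max_card (mem (f @: setX A B)); rewrite e cardsX leqNgt card_AB.
case/dinjectivePn => -[a1 b1] /setXP[a1A b1B].
case=> -[a2 b2] /andP[vNu /setXP[a2A b2B]]; rewrite /f /= => fuv.
have d0 : b2 - b1 != 0.
  apply: contra vNu; rewrite subr_eq0 => /eqP e.
  by move: fuv; rewrite e => /addIr ->.
have dx : (b2 - b1) * x = a1 - a2 by rewrite (canRL (addrK _) fuv); ring.
have in4 s : s \in f @: setX A B ->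
    (b2 - b1) * s \in sumset 4 (prodset A B).
  case/imsetP => -[a b] /setXP[/= aA bB] ->.
  (* Multiplying by [b2 - b1] clears the denominator of [x] and leaves four products; symmetry of
     [B] is what admits the factors [- b1] and [- b]. *)
  have -> : (b2 - b1) * f (a, b) =
      (a * b2 + a * (- b1)) + (a1 * b + a2 * (- b)).
    by rewrite /f /= mulrDr mulrA dx; ring.
  have inP c d : c \in A -> d \in B -> c * d \in sumset 1 (prodset A B).
    by move=> cA dB; apply/sumset1/imset2_f.
  by apply: (@sumsetD _ 2 2); apply: (@sumsetD _ 1 1);
    apply: inP; rewrite ?oppB.
apply/setP => y; rewrite in_setT.
(* Dividing [y] by the nonzero [b2 - b1] allows the decomposition to take place in the undilated
   set; each half then costs four products. *)
have [s sS tS] := large_set_addition (y / (b2 - b1)) large.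
have -> : y = (b2 - b1) * s + (b2 - b1) * (y / (b2 - b1) - s) by field.
by apply: (@sumsetD _ 4 4); apply: in4.
Qed.
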